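(* For every integer $m\ge 2$, the following identity holds in $\mathbb{Z}[a_0,\ldots,a_m]$: $$H_{m-2,1,1}(m) = D(m,m-3)-D(m,m-2)^2 .$$
   Context: Let $m\ge 2$ and let $a_0,\ldots,a_m$ be independent commuting variables over $\mathbb{Z}$; put $a_l:=0$ for every integer $l\notin\{0,\ldots,m\}$. Let $t,T$ be further commuting variables. Let $\mathcal M_1$ be the $m\times m$ matrix over $\mathbb{Z}[a_0,\ldots,a_m][t]$ with $(i,j)$-th entry $a_{2j-i}\,t-a_{2j-i-1}$ ($1\le i,j\le m$). The polynomials $H_{i,j,1}(m)\in\mathbb{Z}[a_0,\ldots,a_m]$ are defined by $$\det(I_m-\mathcal M_1T)=\sum_{i=0}^{m}\sum_{j=0}^{m-i}H_{i,j,1}(m)\,t^jT^{m-i}.$$ Let $\mathcal M_0$ be the $(m-1)\times(m-1)$ matrix over $\mathbb{Z}[a_0,\ldots,a_m]$ with $(i,j)$-th entry $a_{2j-i}$ ($1\le i,j\le m-1$). The polynomials $D(m,i)\in\mathbb{Z}[a_0,\ldots,a_m]$ are defined for $i\in\{0,\ldots,m-1\}$ by $$\det(I_{m-1}-\mathcal M_0T)=\sum_{i=0}^{m-1}D(m,i)\,T^{m-1-i},$$ and $D(m,i):=0$ for $i\notin\{0,\ldots,m-1\}$. *)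

(* Defs.v *)
From mathcomp Require Import all_boot all_order all_algebra all_fingroup.
From mathcomp Require Import mpoly.

Set Implicit Arguments.
Unset Strict Implicit.
Unset Printing Implicit Defensive.

Import Order.TTheory GRing.Theory Num.Theory.

Local Open Scope ring_scope.

(* The variable a_l of Z[a_0, ..., a_m], extended by 0 to all integers l. *)
Definition a_ (m : nat) (l : int) : {mpoly int[m.+1]} :=
  if (0 <= l <= m%:Z) then 'X_(inord (absz l)) else 0.

(* Ordinals start at 0, hence the successors; here 'X is t. *)
Definition M1 (m : nat) : 'M[{poly {mpoly int[m.+1]}}]_m :=
  \matrix_(i < m, j < m)
    ((a_ m (2 * j.+1%:Z - i.+1%:Z))%:P * 'X
     - (a_ m (2 * j.+1%:Z - i.+1%:Z - 1))%:P).

Definition M0 (m : nat) : 'M[{mpoly int[m.+1]}]_(m.-1) :=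
  \matrix_(i < m.-1, j < m.-1) a_ m (2 * j.+1%:Z - i.+1%:Z).

(* det (I_n - A T), where T is the outermost polynomial variable. *)
Definition detT (R : comNzRingType) (n : nat) (A : 'M[R]_n) : {poly R} :=
  \det (1%:M - 'X *: map_mx polyC A).

(* Meaningful for i <= m only; see detT_M1E. *)
Definition H1 (m i j : nat) : {mpoly int[m.+1]} := (detT (M1 m))`_(m - i)`_j.

Definition D (m : nat) (i : int) : {mpoly int[m.+1]} :=
  if (0 <= i <= m%:Z - 1) then (detT (M0 m))`_(absz (m%:Z - 1 - i)%R) else 0.

Lemma size_detT (R : comNzRingType) (n : nat) (A : 'M[R]_n) :
  (size (detT A) <= n.+1)%N.
Proof.
rewrite /detT /determinant; apply: (leq_trans (size_sum _ _ _)).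
apply/bigmax_leqP => s _; rewrite -signr_odd mulr_sign.
have szp : (size (\prod_(i < n) (1%:M - 'X *: map_mx polyC A) i ((s : {perm 'I_n}) i))%R
            <= n.+1)%N.
  apply: (leq_trans (size_poly_prod_leq _ _)).
  rewrite leq_subLR cardT size_enum_ord addnS ltnS addnn -mul2n mulnC.
  rewrite -[X in (_ <= X * 2)%N](card_ord n) -sum_nat_const.
  apply: leq_sum => i _; rewrite !mxE.
  apply: (leq_trans (size_polyD _ _)); rewrite size_polyN geq_max.
  apply/andP; split; first by case: (_ == _); rewrite ?size_poly0 ?size_poly1.
  rewrite mulrC; apply: (leq_trans (size_polyMleq _ _)).
  by rewrite size_polyX addn2 ltnS size_polyC_leq1.
by case: (odd _); rewrite ?size_polyN.
Qed.

Lemma size_coef_detT (R : comNzRingType) (n : nat) (A : 'M[{poly R}]_n)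
    (k : nat) :
  (forall i j, (size (A i j) <= 2)%N) -> (size ((detT A)`_k)%R <= k.+1)%N.
Proof.
move=> szA.
pose P (p : {poly {poly R}}) := forall k, (size (p`_k)%R <= k.+1)%N.
have PD p q : P p -> P q -> P (p + q).
  move=> Pp Pq l; rewrite coefD; apply: (leq_trans (size_polyD _ _)).
  by rewrite geq_max Pp Pq.
have PN p : P p -> P (- p) by move=> Pp l; rewrite coefN size_polyN.
have P0 : P 0 by move=> l; rewrite coef0 size_poly0.
have P1 : P 1.
  by move=> l; rewrite coef1; case: (l == 0)%N; rewrite ?size_poly0 ?size_poly1.
have PM p q : P p -> P q -> P (p * q).
  move=> Pp Pq l; rewrite coefM; apply: (leq_trans (size_sum _ _ _)).
  apply/bigmax_leqP => i _; apply: (leq_trans (size_polyMleq _ _)).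
  rewrite -ltnS; have := leq_add (Pp i) (Pq (l - i)%N).
  rewrite addSn addnS subnKC -1?ltnS // => le_l.
  by case: (_ + _)%N le_l.
suff PA : P (detT A) by apply: PA.
rewrite /detT /determinant; apply: (big_ind P); [exact: P0|exact: PD|] => s _.
apply: (PM); first by rewrite -signr_odd; case: (odd _) => //=; apply: (PN).
apply: (big_ind P); [exact: P1|exact: PM|] => i _; rewrite !mxE; apply: PD.
  by case: (_ == _).
apply: PN; case=> [|[|l]]; rewrite coefXM ?size_poly0 //= coefC /= ?size_poly0 //.
Qed.

(* The coefficient of T^k has t-degree at most k. *)
Lemma size_coef_detT_M1 (m k : nat) : (size ((detT (M1 m))`_k)%R <= k.+1)%N.
Proof.
apply: size_coef_detT => i j; rewrite mxE.
apply: (leq_trans (size_polyD _ _)); rewrite size_polyN geq_max.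
rewrite (leq_trans (size_polyC_leq1 _)) // andbT.
apply: (leq_trans (size_polyMleq _ _)).
by rewrite size_polyX addn2 ltnS size_polyC_leq1.
Qed.

Lemma poly_sum_rev (R : nzRingType) (n : nat) (p : {poly R}) :
  (size p <= n.+1)%N -> p = \sum_(0 <= i < n.+1) (p`_(n - i))%:P * 'X^(n - i).
Proof.
move=> szp; rewrite big_nat_rev big_mkord /=; apply/polyP => k.
rewrite coef_sum; under eq_bigr => i _.
  rewrite add0n subSS subKn -1?ltnS // coefCM coefXn; over.
have [lt_kn|le_nk] := ltnP k n.+1; last first.
  rewrite nth_default ?(leq_trans szp) // big1 // => i _.
  by rewrite gtn_eqF ?mulr0 // (leq_trans (ltn_ord i)).
rewrite (bigD1 (Ordinal lt_kn)) //= eqxx mulr1 big1 ?addr0 // => i ne_ik.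
rewrite [k == i]eq_sym; case: eqP => [eq_ik|_]; last by rewrite mulr0.
by case/eqP: ne_ik; apply: val_inj.
Qed.

Lemma poly_sum (R : nzRingType) (n : nat) (p : {poly R}) :
  (size p <= n.+1)%N -> p = \sum_(0 <= i < n.+1) (p`_i)%:P * 'X^i.
Proof.
move=> szp; rewrite {1}(poly_sum_rev szp) big_nat_rev /=.
by apply: eq_big_nat => i /= lt_in; rewrite add0n subSS subKn -1?ltnS.
Qed.

(* The expansions by which the H1 m i j and the D m i are defined. *)
Lemma detT_M1E (m : nat) :
  detT (M1 m) = \sum_(0 <= i < m.+1) \sum_(0 <= j < (m - i).+1)
                  (H1 m i j)%:P%:P * ('X^j)%:P * 'X^(m - i).
Proof.
rewrite [LHS](poly_sum_rev (size_detT _)); apply: eq_big_nat => i _.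
rewrite {1}(poly_sum (size_coef_detT_M1 m (m - i))) rmorph_sum mulr_suml.
by apply: eq_bigr => j _; rewrite rmorphM.
Qed.

Lemma detT_M0E (m : nat) : (0 < m)%N ->
  detT (M0 m) = \sum_(0 <= i < m) (D m i%:Z)%:P * 'X^(m - 1 - i).
Proof.
case: m => // m _; rewrite [LHS](poly_sum_rev (size_detT _)).
apply: eq_big_nat => i /= lt_im; rewrite subSS subn0 /D.
have -> : m.+1%:Z - 1 = m%:Z by rewrite -addn1 PoszD addrK.
by rewrite !lez_nat /= -ltnS lt_im subzn.
Qed.

(* Main.v *)
(* Write M1 = A t - B. By Newton's identities, the claim times 2 is the relation
     2 (tr (A B) - tr A tr B) = - (tr M0)^2 - tr (M0^2).
   For all p, q in {0, ..., m}, the product a_p a_q occurs exactly once in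
   tr (A B) if p = q + 1 mod 3, exactly once in tr (M0^2) + a_0^2 + a_m^2 if
   p = q mod 3, and nowhere else. The classes p = q + 1 and p = q - 1 mod 3 are
   exchanged by swapping p and q, so summing over the three classes gives
     2 tr (A B) + tr (M0^2) + a_0^2 + a_m^2 = (a_0 + ... + a_m)^2,
   where tr A, tr B, tr M0 omit a_0, a_m, and both, from a_0 + ... + a_m. *)

Require Import Defs.
From mathcomp Require Import all_boot all_order all_algebra.
From mathcomp Require Import perm mpoly zify ring.

Set Implicit Arguments.
Unset Strict Implicit.
Unset Printing Implicit Defensive.

Import Order.TTheory GRing.Theory Num.Theory.

Local Open Scope ring_scope.

Lemma deriv_prod_seq (R : comNzRingType) (I : eqType) (r : seq I)
    (F : I -> {poly R}) : uniq r ->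
  (\prod_(i <- r) F i)^`()
  = \sum_(i <- r) (F i)^`() * \prod_(j <- r | j != i) F j.
Proof.
elim: r => [_|i r IHr /= /andP[r'i /IHr{}IHr]].
  by rewrite !big_nil -polyC1 derivC.
rewrite !big_cons eqxx derivM IHr mulr_sumr; congr (_ * _ + _).
  rewrite big_seq [RHS]big_seq_cond; apply: eq_bigl => j.
  by case: (boolP (j \in r)) => //= /(memPn r'i) ->.
apply: eq_big_seq => j /(memPn r'i) neq_ji.
by rewrite big_cons eq_sym neq_ji mulrCA.
Qed.

Lemma deriv_det (R : comNzRingType) (n : nat) (M : 'M[{poly R}]_n) :
  (\det M)^`() = \sum_i \sum_j (M i j)^`() * cofactor M i j.
Proof.
rewrite /determinant raddf_sum /=.
under eq_bigr => s _.
  rewrite -signr_odd mulr_sign (fun_if (@deriv R)) derivN -mulr_sign signr_odd.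
  rewrite deriv_prod_seq ?index_enum_uniq // mulr_sumr; over.
rewrite exchange_big /=; apply: eq_bigr => i _.
rewrite (partition_big (fun s : 'S_n => s i) xpredT) //=.
apply: eq_bigr => j _; rewrite expand_cofactor mulr_sumr.
apply: eq_bigr => s /eqP ->; rewrite mulrCA; congr (_ * (_ * _)).
by apply: eq_bigl => k; rewrite eq_sym.
Qed.

Definition rev_char_mx (R : nzRingType) (n : nat) (A : 'M[R]_n) :
    'M[{poly R}]_n :=
  1%:M - 'X *: map_mx polyC A.

Section NewtonIdentities.

Variables (R : comNzRingType) (n : nat) (A : 'M[R]_n).

Lemma detT_coef0 : (detT A)`_0 = 1.
Proof.
rewrite -horner_coef0 -horner_evalE -det_map_mx raddfB /= map_scalar_mx.
rewrite map_mxZ /= !horner_evalE hornerX scale0r subr0 hornerC.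
exact: det1.
Qed.

Local Notation M := (rev_char_mx A).

Lemma coef_adj_rev_char_mx (k : nat) :
  map_mx (coefp k) (\adj M) = \sum_(l < k.+1) (detT A)`_l *: A ^+ (k - l).
Proof.
have adjE : \adj M = (detT A)%:M + 'X *: (map_mx polyC A *m \adj M).
  by rewrite -(mul_mx_adj M) mulmxBl mul1mx -scalemxAl subrK.
have coef0_mulX (B : 'M[{poly R}]_n) : map_mx (coefp 0) ('X *: B) = 0.
  by apply/matrixP => i j; rewrite !mxE /= coefXM.
have coefS_mulX l (B : 'M[{poly R}]_n) :
    map_mx (coefp l.+1) ('X *: (map_mx polyC A *m B))
    = A *m map_mx (coefp l) B.
  apply/matrixP => i j; rewrite !mxE /= coefXM /= coef_sum.
  by apply: eq_bigr => x _; rewrite !mxE coefCM.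
have coef_scalar l (p : {poly R}) :
    map_mx (coefp l) (p%:M : 'M_n) = (p`_l)%:M.
  by apply/matrixP => i j; rewrite !mxE /= coefMn.
elim: k => [|k IHk]; rewrite adjE map_mxD coef_scalar addrC.
  by rewrite coef0_mulX add0r big_ord1 detT_coef0 scale1r.
rewrite coefS_mulX IHk mulmx_sumr [RHS]big_ord_recr /= subnn expr0 scalemx1.
congr (_ + _).
by apply: eq_bigr => l _; rewrite -scalemxAr mulmxE -exprS -subSn -1?ltnS.
Qed.

Lemma detT_newton (k : nat) :
  (detT A)`_k *+ k = - \sum_(l < k) (detT A)`_l * \tr (A ^+ (k - l)).
Proof.
case: k => [|k]; first by rewrite big_ord0 oppr0.
have -> : (detT A)`_k.+1 *+ k.+1 = - \tr (A *m map_mx (coefp k) (\adj M)).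
  rewrite -coef_deriv deriv_det coef_sum -sumrN; apply: eq_bigr => i _.
  rewrite mxE coef_sum -sumrN; apply: eq_bigr => j _; rewrite !mxE.
  rewrite derivB derivMn -polyC1 derivC mul0rn sub0r derivM derivX derivC.
  by rewrite mulr0 addr0 mul1r mulNr coefN coefCM.
rewrite coef_adj_rev_char_mx mulmx_sumr (raddf_sum (@mxtrace R n)) /=.
congr (- _); apply: eq_bigr => l _.
by rewrite -scalemxAr mxtraceZ mulmxE -exprS -subSn -1?ltnS.
Qed.

Lemma detT_coef1 : (detT A)`_1 = - \tr A.
Proof.
have := detT_newton 1.
by rewrite big_ord1 detT_coef0 mul1r.
Qed.

Lemma detT_coef2 : (detT A)`_2 *+ 2 = \tr A ^+ 2 - \tr (A *m A).
Proof.
rewrite detT_newton big_ord_recr big_ord1 /= detT_coef0 detT_coef1.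
by rewrite expr1 mulmxE; ring.
Qed.

End NewtonIdentities.

(* The factor 2 comes from Newton's identities and may be a zero divisor. *)
Lemma detT_pencil_coef (R : comNzRingType) (n : nat) (A B : 'M[R]_n) :
  (detT ('X *: map_mx polyC A - map_mx polyC B))`_2`_1 *+ 2
  = (\tr (A *m B) - \tr A * \tr B) *+ 2.
Proof.
set P := _ - _.
have trP_sqr : \tr P ^+ 2 = (\tr A ^+ 2)%:P * 'X^2
    - (\tr A * \tr B *+ 2)%:P * 'X + (\tr B ^+ 2)%:P.
  rewrite /P raddfB /= mxtraceZ !trace_map_mx /=.
  by rewrite !(rmorphXn, rmorphMn, rmorphM) /=; ring.
have trPP : \tr (P *m P) = (\tr (A *m A))%:P * 'X^2
    - (\tr (A *m B) *+ 2)%:P * 'X + (\tr (B *m B))%:P.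
  rewrite mulmxBl !mulmxBr -!scalemxAl -!scalemxAr -!map_mxM.
  rewrite !(raddfB (@mxtrace _ n)) /= !mxtraceZ !trace_map_mx (mxtrace_mulC B).
  by rewrite rmorphMn /=; ring.
rewrite -coefMn detT_coef2 trP_sqr trPP.
rewrite !(coefB, coefD, coefMXn, coefMX, coefC) /=.
by ring.
Qed.

Lemma reindex_codom (R : Type) (idx : R) (op : Monoid.com_law idx)
    (T : eqType) (I J : finType) (f : I -> T) (g : J -> T) (F : T -> R) :
    injective f -> injective g -> (forall t, t \notin codom g -> F t = idx) ->
  \big[op/idx]_i F (f i) = \big[op/idx]_(j | g j \in codom f) F (g j).
Proof.
move=> inj_f inj_g F_out.
rewrite -(big_image _ _ f predT F).
rewrite -(big_image_cond _ _ g predT (mem (codom f)) F).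
rewrite -(big_rmcond _ _ F_out) -big_filter -[RHS]big_filter.
apply: perm_big; apply: uniq_perm; first 2 last.
- by move=> t; rewrite !mem_filter andbC.
- by rewrite filter_uniq // map_inj_uniq ?enum_uniq.
- by rewrite filter_uniq // map_inj_uniq ?enum_uniq.
Qed.

(* The shape of the Hurwitz stability matrices. *)
Definition hurwitz_mx (R : Type) (n : nat) (a : int -> R) : 'M[R]_n :=
  \matrix_(i < n, j < n) a (2 * j.+1%:Z - i.+1%:Z).

Definition mod3_sum (R : pzSemiRingType) (n d : nat) (a b : 'I_n -> R) : R :=
  \sum_(x : 'I_n * 'I_n | x.1 == x.2 + d %[mod 3]%N) a x.1 * b x.2.

Lemma sum_mul_mod3 (R : comPzSemiRingType) (n : nat) (a b : 'I_n -> R) :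
  (\sum_p a p) * (\sum_q b q)
  = mod3_sum 0 a b + mod3_sum 1 a b + mod3_sum 1 b a.
Proof.
have -> : mod3_sum 1 b a =
    \sum_(x : 'I_n * 'I_n | x.2 == x.1 + 1 %[mod 3]%N) a x.1 * b x.2.
  rewrite /mod3_sum (reindex_inj (inv_inj swap_pairK)).
  by apply: eq_bigr => x _; rewrite mulrC.
rewrite big_distrlr pair_big /= -addrA /mod3_sum.
pose cong3 d (x : 'I_n * 'I_n) := (x.1 == x.2 + d %[mod 3])%N.
rewrite (bigID (cong3 0)) /= [X in _ + X](bigID (cong3 1)) /= /cong3.
by congr (_ + (_ + _)); apply: eq_bigl => x; lia.
Qed.

Definition vanishes_outside (R : nmodType) (m : nat) (a : int -> R) : Prop :=
  forall l : int, ~~ (0 <= l <= m%:Z) -> a l = 0.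

Section HurwitzTraces.

Variables (R : comNzRingType) (m : nat) (a b : int -> R).
Hypothesis a_out : vanishes_outside m a.
Hypothesis b_out : vanishes_outside m b.

(* With p = 2j - i and q = 2i - j - d, one has 3i = p + 2q + 2d and
   3j = 2p + q + d. *)
Lemma mxtrace_mul_hurwitz (n d : nat) :
  \tr (hurwitz_mx n a *m hurwitz_mx n (fun l => b (l - d%:Z)))
  = \sum_(x : 'I_m.+1 * 'I_m.+1 |
       [&& x.1 == x.2 + d %[mod 3], 0 < x.1 + 2 * x.2 + 2 * d <= 3 * n
         & 0 < 2 * x.1 + x.2 + d <= 3 * n]%N)
      a x.1%:Z * b x.2%:Z.
Proof.
pose f (x : 'I_n * 'I_n) : int * int :=
  (2 * x.2.+1%:Z - x.1.+1%:Z, 2 * x.1.+1%:Z - x.2.+1%:Z - d%:Z).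
pose g (x : 'I_m.+1 * 'I_m.+1) : int * int := (x.1%:Z, x.2%:Z).
pose F (t : int * int) : R := a t.1 * b t.2.
have inj_f : injective f.
  by case=> [i j] [i' j'] [] *; congr pair; apply: val_inj => /=; lia.
have inj_g : injective g.
  by case=> [p q] [p' q'] [] *; congr pair; apply: val_inj.
have F_out t : t \notin codom g -> F t = 0.
  case: t => p q; rewrite /F /=.
  have [p_in|/a_out->] := boolP (0 <= p <= m%:Z); last by rewrite mul0r.
  have [q_in|/b_out->] := boolP (0 <= q <= m%:Z); last by rewrite mulr0.
  case/codomP; exists (inord `|p|, inord `|q|).
  by rewrite /g /= !inordK; [congr pair|..]; lia.
transitivity (\sum_x F (f x)).
  rewrite -(pair_bigA _ (fun i j => F (f (i, j)))) /=.
  by apply: eq_bigr => i _; rewrite mxE; apply: eq_bigr => j _; rewrite !mxE.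
rewrite (reindex_codom _ inj_f inj_g F_out).
apply: eq_bigl => -[p q] /=; apply/codomP/idP => [[[i j] []] | pq_in].
  by move=> /=; have := ltn_ord i; have := ltn_ord j; lia.
have i_lt : (((p + 2 * q + 2 * d) %/ 3).-1 < n)%N by lia.
have j_lt : (((2 * p + q + d) %/ 3).-1 < n)%N by lia.
by exists (Ordinal i_lt, Ordinal j_lt); rewrite /f /g /=; congr pair; lia.
Qed.

Lemma mxtrace_mul_hurwitz_shift :
  \tr (hurwitz_mx m a *m hurwitz_mx m (fun l => b (l - 1)))
  = mod3_sum 1 (fun p : 'I_m.+1 => a p%:Z) (fun q => b q%:Z).
Proof.
rewrite (mxtrace_mul_hurwitz m 1); apply: eq_bigl => -[p q] /=.
by have := ltn_ord p; have := ltn_ord q; lia.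
Qed.

Lemma mxtrace_mul_hurwitz_pred : (0 < m)%N ->
  \tr (hurwitz_mx m.-1 a *m hurwitz_mx m.-1 b) + a 0 * b 0 + a m%:Z * b m%:Z
  = mod3_sum 0 (fun p : 'I_m.+1 => a p%:Z) (fun q => b q%:Z).
Proof.
move=> m_gt0.
have -> : hurwitz_mx m.-1 b = hurwitz_mx m.-1 (fun l => b (l - 0)).
  by apply/matrixP => i j; rewrite !mxE subr0.
rewrite (mxtrace_mul_hurwitz m.-1 0) /mod3_sum.
rewrite [RHS](bigD1 (ord0, ord0)) // [in RHS](bigD1 (ord_max, ord_max)) /=;
  last by rewrite xpair_eqE -!val_eqE /=; lia.
rewrite [RHS]addrA [RHS]addrC [RHS]addrA; congr (_ + _ + _).
apply: eq_bigl => -[p q]; rewrite !xpair_eqE -!val_eqE /=.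
by have := ltn_ord p; have := ltn_ord q; lia.
Qed.

End HurwitzTraces.

Lemma sum_mul_mxtrace_hurwitz (R : comNzRingType) (m : nat) (a b : int -> R) :
    vanishes_outside m a -> vanishes_outside m b -> (0 < m)%N ->
  \tr (hurwitz_mx m.-1 a *m hurwitz_mx m.-1 b) + a 0 * b 0 + a m%:Z * b m%:Z
  + \tr (hurwitz_mx m a *m hurwitz_mx m (fun l => b (l - 1)))
  + \tr (hurwitz_mx m b *m hurwitz_mx m (fun l => a (l - 1)))
  = (\sum_(p < m.+1) a p%:Z) * \sum_(q < m.+1) b q%:Z.
Proof.
move=> a_out b_out m_gt0; rewrite sum_mul_mod3.
by rewrite mxtrace_mul_hurwitz_pred // !mxtrace_mul_hurwitz_shift.
Qed.

Lemma mxtrace_hurwitz (R : pzSemiRingType) (n : nat) (a : int -> R) :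
  \tr (hurwitz_mx n a) = \sum_(i < n) a i.+1%:Z.
Proof. by apply: eq_bigr => i _; rewrite mxE; congr a; lia. Qed.

Lemma mxtrace_hurwitz_shift (R : pzSemiRingType) (n : nat) (a : int -> R) :
  \tr (hurwitz_mx n (fun l => a (l - 1))) = \sum_(i < n) a i%:Z.
Proof. by rewrite mxtrace_hurwitz; apply: eq_bigr => i _; congr a; lia. Qed.

Lemma mxtrace_hurwitz_pencil (R : comNzRingType) (m : nat) (a : int -> R)
    (A := hurwitz_mx m a) (B := hurwitz_mx m (fun l => a (l - 1)))
    (C := hurwitz_mx m.-1 a) : vanishes_outside m a -> (0 < m)%N ->
  (\tr (A *m B) - \tr A * \tr B) *+ 2 = - \tr C ^+ 2 - \tr (C *m C).
Proof.
move=> a_out m_gt0; set S := \sum_(p < m.+1) a p%:Z.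
have trA : \tr A = S - a 0.
  by rewrite mxtrace_hurwitz /S big_ord_recl addrC addKr.
have trB : \tr B = S - a m%:Z.
  by rewrite mxtrace_hurwitz_shift /S big_ord_recr addrK.
have trC : \tr C = S - a 0 - a m%:Z.
  rewrite -trA !mxtrace_hurwitz -[in RHS](prednK m_gt0) big_ord_recr /=.
  by rewrite prednK // addrK.
have trAB : \tr (A *m B) *+ 2 = S ^+ 2 - a 0 ^+ 2 - a m%:Z ^+ 2 - \tr (C *m C).
  rewrite expr2 -(sum_mul_mxtrace_hurwitz a_out a_out m_gt0) -/A -/B -/C.
  ring.
by rewrite mulrnBl trAB trA trB trC; ring.
Qed.

Lemma a_vanishes_outside (m : nat) : vanishes_outside m (a_ m).
Proof. by move=> l /negPf l_out; rewrite /a_ l_out. Qed.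

Lemma M1_hurwitz (m : nat) :
  M1 m = 'X *: map_mx polyC (hurwitz_mx m (a_ m))
         - map_mx polyC (hurwitz_mx m (fun l => a_ m (l - 1))).
Proof. by apply/matrixP => i j; rewrite !mxE mulrC. Qed.

Lemma D_detT (m k : nat) : (0 < m)%N ->
  D m (m%:Z - 1 - k%:Z) = (detT (M0 m))`_k.
Proof.
move=> m_gt0; rewrite /D; case: ifP => k_in; first by congr (_ `_ _); lia.
by rewrite nth_default // (leq_trans (size_detT _)) //; lia.
Qed.

Lemma mulrn_injective (R : idomainType) (k : nat) :
  k%:R != 0 :> R -> injective (fun x : R => x *+ k).
Proof.
move=> k_neq0 x y; rewrite -(mulr_natl x) -(mulr_natl y).
exact: mulfI k_neq0 _ _.
Qed.

Theorem theorem2p1 (m : nat) (hm : (2 <= m)%N) :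
  H1 m (m - 2)%N 1%N = D m (m%:Z - 3) - D m (m%:Z - 2) ^+ 2.
Proof.
have m_gt0 : (0 < m)%N by exact: ltnW.
have two_neq0 : 2%:R != 0 :> {mpoly int[m.+1]}.
  by rewrite -mpolyC_nat mpolyC_eq0.
apply: (mulrn_injective two_neq0).
have -> : D m (m%:Z - 2) = - \tr (M0 m).
  by rewrite -detT_coef1 -D_detT //; congr (D m _); lia.
have -> : D m (m%:Z - 3) = (detT (M0 m))`_2.
  by rewrite -D_detT //; congr (D m _); lia.
rewrite /H1 subKn // M1_hurwitz detT_pencil_coef.
rewrite (mxtrace_hurwitz_pencil (@a_vanishes_outside m) m_gt0).
rewrite mulrnBl detT_coef2 sqrrN -[hurwitz_mx m.-1 _]/(M0 m).
by ring.
Qed.
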